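(* Let $(Z_t)_{t\ge 0}=(X_t,\Theta_t)_{t\ge0}$ be the original Zig-Zag process on $E=\mathbb{R}^d\times\{-1,+1\}^d$ targeting the probability measure $\pi(dx)=\frac1H e^{-U(x)}dx$ on $\mathbb{R}^d$. Suppose that $\pi$ is heavy-tailed, i.e. for every $a>0$, $$\lim_{R\to+\infty}\pi\big(B(0,R)^c\big)\,e^{aR}=+\infty ,$$ where $B(0,R)$ is the ball of radius $R$ centred at $0$. Then the process is not exponentially ergodic.
   Context: Setting: $U\in C^1(\mathbb{R}^d)$ with $H=\int_{\mathbb{R}^d}e^{-U(x)}dx<\infty$; $\mu(dx,d\theta)=\frac{1}{2^dH}e^{-U(x)}dx\,d\theta$ is a probability measure on $E$ ($d\theta$ is counting measure on $\{-1,+1\}^d$), with first marginal $\pi$. Original Zig-Zag process: for $\theta\in\{-1,+1\}^d$ let $F_j(\theta)$ be $\theta$ with the sign of its $j$-th coordinate flipped. The switching rates are $\lambda_i(x,\theta)=[\theta_i\partial_iU(x)]^++\gamma_i(x,\theta_{-i})$, $i=1,\dots,d$, where $a^+=\max\{a,0\}$ and $\gamma_i\ge 0$ does not depend on the $i$-th component of $\theta$; it is assumed that $t\mapsto\lambda_i(x+\theta t,\theta)$ is locally integrable. Started from $(x,\theta)$, the process moves as $X_t=x+\theta t$, $\Theta_t=\theta$ until time $T=\min_iT_i$, where $T_1,\dots,T_d$ are independent and $T_i$ is the first event time of an inhomogeneous Poisson process with rate $t\mapsto\lambda_i(x+\theta t,\theta)$. At time $T$ the velocity becomes $F_j(\theta)$,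 where $j=\arg\min_iT_i$, and the construction restarts from the new state. This process has $\mu$ as invariant measure. Exponentially ergodic: there exist $M:E\to[1,+\infty)$ and $\rho<1$ such that for all $(x,\theta)\in E$ and $t\ge0$, $\|\mathbb{P}_{x,\theta}(Z_t\in\cdot)-\mu(\cdot)\|_{TV}\le M(x,\theta)\rho^t$. *)

(* Defs.v *)
From HB Require Import structures.
From mathcomp Require Import all_boot all_order all_algebra.
From mathcomp Require Import all_classical all_reals all_analysis.
From mathcomp Require Import measurable_realfun.

Set Implicit Arguments.
Unset Strict Implicit.
Unset Printing Implicit Defensive.

Import Order.TTheory GRing.Theory Num.Theory.
Import numFieldNormedType.Exports.

Local Open Scope classical_set_scope.
Local Open Scope ring_scope.

(* The product sigma-algebra on row vectors, as measure_tuple_display does for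
   tuples; for T := R it is the Borel sigma-algebra of R^n. *)
Definition measure_rV_display : measure_display -> measure_display.
Proof. exact. Qed.

Section measurable_rV.
Context {d} {T : sigmaRingType d}.
Variable n : nat.

Let coors : 'I_n -> 'rV[T]_n -> T := fun i x => x ord0 i.

Let rV_set0 : g_sigma_preimage coors set0.
Proof. exact: sigma_algebra0. Qed.

Let rV_setC A : g_sigma_preimage coors A -> g_sigma_preimage coors (~` A).
Proof. exact: sigma_algebraC. Qed.

Let rV_bigcup (F : _^nat) : (forall i, g_sigma_preimage coors (F i)) ->
  g_sigma_preimage coors (\bigcup_i (F i)).
Proof. exact: sigma_algebra_bigcup. Qed.

HB.instance Definition _ := @isMeasurable.Build (measure_rV_display d)
  'rV[T]_n (g_sigma_preimage coors) rV_set0 rV_setC rV_bigcup.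

End measurable_rV.

Section measurable_rV_theory.
Context {d1 d2} {T1 : measurableType d1} {T2 : measurableType d2}.

Lemma measurable_rV_coor n (i : 'I_n) :
  measurable_fun [set: 'rV[T1]_n] (fun x => x ord0 i).
Proof.
move=> _ Y mY; rewrite setTI; apply: sub_sigma_algebra.
rewrite -bigcup_seq/=; exists i; first by rewrite /= mem_index_enum.
by exists Y => //; rewrite setTI.
Qed.

Lemma measurable_fun_rVP n (f : T2 -> 'rV[T1]_n) :
  (forall i, measurable_fun setT (fun x => f x ord0 i)) -> measurable_fun setT f.
Proof.
move=> mf; apply: (@measurability _ _ _ _ _ _
  (\big[setU/set0]_(i < n) preimage_set_system setT
    (fun x : 'rV[T1]_n => x ord0 i) measurable)); first by [].
move=> _ [B + <-]; rewrite -bigcup_seq => -[i _ [A mA <-]].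
rewrite setTI.
have := mf i measurableT A mA; rewrite !setTI; exact.
Qed.

End measurable_rV_theory.

Section lebesgue_measure_rV.
Variable R : realType.

Definition rV_cons n (p : R * 'rV[R]_n) : 'rV[R]_n.+1 :=
  \row_i oapp (p.2 ord0) p.1 (unlift ord0 i).

Definition rV_uncons n (v : 'rV[R]_n.+1) : R * 'rV[R]_n :=
  (v ord0 ord0, \row_i v ord0 (lift ord0 i)).

Lemma rV_consK n : cancel (@rV_cons n) (@rV_uncons n).
Proof.
move=> [a v]; rewrite /rV_uncons /rV_cons; congr pair => /=.
  by rewrite mxE unlift_none.
by apply/rowP => i; rewrite !mxE liftK.
Qed.

Lemma measurable_rV_cons n : measurable_fun setT (@rV_cons n).
Proof.
apply: measurable_fun_rVP => i; rewrite /rV_cons.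
case: (unliftP ord0 i) => [j ->|->].
  apply: (eq_measurable_fun (fun p : R * 'rV[R]_n => p.2 ord0 j)).
    by move=> p _; rewrite mxE liftK.
  exact: (measurableT_comp (@measurable_rV_coor _ _ n j) measurable_snd).
apply: (eq_measurable_fun (fun p : R * 'rV[R]_n => p.1)).
  by move=> p _; rewrite mxE unlift_none.
exact: measurable_fst.
Qed.

Lemma measurable_rV_uncons n : measurable_fun setT (@rV_uncons n).
Proof.
apply/measurable_fun_pairP; split; first exact: measurable_rV_coor.
apply: measurable_fun_rVP => i /=.
apply: (eq_measurable_fun (fun v : 'rV[R]_n.+1 => v ord0 (lift ord0 i))).
  by move=> p _; rewrite /= mxE.
exact: measurable_rV_coor.
Qed.

Section step.
Variables (n : nat) (m : {sigma_finite_measure set 'rV[R]_n -> \bar R}).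

Definition rV_cons_measure : set 'rV[R]_n.+1 -> \bar R :=
  pushforward (@lebesgue_measure R \x m)%E (@rV_cons n).

Let measurable_rV_cons_preimage (A : set 'rV[R]_n.+1) : measurable A ->
  measurable (@rV_cons n @^-1` A : set (measurableTypeR R * 'rV[R]_n)).
Proof.
by move=> mA; rewrite -[X in measurable X]setTI; exact: measurable_rV_cons.
Qed.

Let rV_cons_measure0 : rV_cons_measure set0 = 0%E.
Proof. by rewrite /rV_cons_measure /pushforward preimage_set0 measure0. Qed.

Let rV_cons_measure_ge0 A : (0 <= rV_cons_measure A)%E.
Proof. by rewrite /rV_cons_measure /pushforward measure_ge0. Qed.

Let rV_cons_measure_sigma_additive : semi_sigma_additive rV_cons_measure.
Proof.
move=> F mF tF mUF; rewrite /rV_cons_measure /pushforward preimage_bigcup.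
apply: measure_semi_sigma_additive.
- by move=> k; exact: measurable_rV_cons_preimage.
- apply/trivIsetP => i j _ _ ij; rewrite -preimage_setI.
  by move/trivIsetP : tF => /(_ _ _ _ _ ij) ->//; rewrite preimage_set0.
- by rewrite -preimage_bigcup; exact: measurable_rV_cons_preimage.
Qed.

HB.instance Definition _ := isMeasure.Build _ _ _ rV_cons_measure
  rV_cons_measure0 rV_cons_measure_ge0 rV_cons_measure_sigma_additive.

Let rV_cons_measure_sigma_finite : sigma_finite setT rV_cons_measure.
Proof.
have /sigma_finiteP[F [FT ndF Foo]] := sigma_finiteT (@lebesgue_measure R).
have /sigma_finiteP[G [GT ndG Goo]] := sigma_finiteT m.
exists (fun k => @rV_uncons n @^-1` (F k `*` G k)).
  rewrite -preimage_bigcup (_ : \bigcup_k _ = setT) ?preimage_setT//.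
  rewrite -subTset => -[x y] _.
  have [i _ Fix] : (\bigcup_i F i) x by rewrite -FT.
  have [j _ Gjy] : (\bigcup_i G i) y by rewrite -GT.
  exists (maxn i j) => //; split.
    by move: x Fix; exact/subsetPset/ndF/leq_maxl.
  by move: y Gjy; exact/subsetPset/ndG/leq_maxr.
move=> k; have [mF Fk] := Foo k; have [mG Gk] := Goo k; split.
  rewrite -[X in measurable X]setTI; apply: measurable_rV_uncons => //.
  exact: measurableX.
rewrite /rV_cons_measure /pushforward (_ : _ @^-1` _ = F k `*` G k).
  by rewrite product_measure1E// lte_mul_pinfty// ge0_fin_numE.
rewrite -comp_preimage (_ : _ \o _ = id) ?preimage_id//.
by apply/funext => p; rewrite [LHS]rV_consK.
Qed.

HB.instance Definition _ := Measure_isSigmaFinite.Build _ _ _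
  rV_cons_measure rV_cons_measure_sigma_finite.

End step.

Fixpoint lebesgue_measure_rV n : {sigma_finite_measure set 'rV[R]_n -> \bar R} :=
  match n with
  | 0 => \d_(0 : 'rV[R]_0)
  | n.+1 => rV_cons_measure (lebesgue_measure_rV n)
  end.

End lebesgue_measure_rV.
Arguments lebesgue_measure_rV {R}.

Section target.
Context {R : realType} {d : nat}.
Implicit Types (U : 'rV[R]_d -> R) (x : 'rV[R]_d).

Definition partial U (i : 'I_d) x : R := 'D_(delta_mx ord0 i) U x.

Definition C1 U :=
  (forall x, differentiable U x) /\ forall i, continuous (partial U i).

(* The norm of the normed module 'rV[R]_d is the sup norm. *)
Definition euclidean_norm x : R := Num.sqrt (\sum_(i < d) x ord0 i ^+ 2).

Definition euclidean_ball0 (r : R) : set 'rV[R]_d :=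
  [set x | euclidean_norm x < r].

Definition normalization U : \bar R :=
  (\int[lebesgue_measure_rV d]_x (expR (- U x))%:E)%E.

Definition target_measure U (A : set 'rV[R]_d) : \bar R :=
  ((fine (normalization U))^-1%:E *
   \int[lebesgue_measure_rV d]_(x in A) (expR (- U x))%:E)%E.

Definition heavy_tailed (pi : set 'rV[R]_d -> \bar R) :=
  forall a : R, 0 < a ->
    (pi (~` euclidean_ball0 r) * (expR (a * r))%:E)%E @[r --> +oo] --> +oo%E.

End target.

Section zigzag.
Context {R : realType} {d : nat}.

(* A velocity theta in {-1, +1}^d is stored as its tuple of sign bits, the bit
   true standing for -1. *)
Local Notation velocity := (d.-tuple bool).
Local Notation state := ('rV[R]_d * velocity)%type.

Definition sgv (v : velocity) (i : 'I_d) : R := (-1) ^+ tnth v i.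

Definition vec (v : velocity) : 'rV[R]_d := \row_i sgv v i.

Definition flip (j : 'I_d) (v : velocity) : velocity :=
  [tuple if i == j then ~~ tnth v i else tnth v i | i < d].

Definition extended_target (U : 'rV[R]_d -> R) (A : set state) : \bar R :=
  ((2 ^+ d)^-1%:E *
   \sum_(v : velocity) target_measure U [set x | A (x, v)])%E.

Definition independent_of_own_coordinate
    (gamma : 'I_d -> 'rV[R]_d -> velocity -> R) :=
  forall i x (v w : velocity), (forall j, j != i -> tnth v j = tnth w j) ->
    gamma i x v = gamma i x w.

Definition switching_rate (U : 'rV[R]_d -> R)
    (gamma : 'I_d -> 'rV[R]_d -> velocity -> R) (i : 'I_d) (z : state) : R :=
  Num.max (sgv z.2 i * partial U i z.1) 0 + gamma i z.1 z.2.

Definition rate_along (lambda : 'I_d -> state -> R) (i : 'I_d) (z : state)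
    (t : R) : R :=
  lambda i (z.1 + t *: vec z.2, z.2).

(* A candidate vector (T_1, ..., T_d) of event times; +oo means no event. *)
Local Notation clocks := (d.-tuple (\bar R)).

Definition first_clock (tau : clocks) : \bar R :=
  \big[Order.min/+oo%E]_(i < d) tnth tau i.

(* The pair of the last switching time and of the state just after it. If no
   clock rings the next switching time is +oo, and the state stored with it is
   never visited. *)
Definition switch (tau : clocks) (sz : \bar R * state) : \bar R * state :=
  let T := first_clock tau in
  let: (s, (x, v)) := sz in
  ((s + T)%E,
   (x + fine T *: vec v,
    if [pick j | tnth tau j == T] is Some j then flip j v else v)).

Fixpoint skeleton (z : state) (tau : nat -> clocks) (n : nat) :
    \bar R * state :=
  if n is m.+1 then switch (tau m) (skeleton z tau m) else (0%E, z).

(* The state at time t; it is None from the first accumulation point of the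
   switching times on, if there is one. *)
Definition zigzag_path (z : state) (tau : nat -> clocks) (t : R) :
    option state :=
  xget None [set o | exists n,
    let: (s, (x, v)) := skeleton z tau n in
    (s <= t%:E < (skeleton z tau n.+1).1)%E /\
    o = Some (x + (t - fine s) *: vec v, v)].

Section realization.
Context {dO : measure_display} {Omega : measurableType dO}.
Variable T : nat -> Omega -> d.-tuple (\bar R).

Definition past (n : nat) (w : Omega) : n.-tuple (d.-tuple (\bar R)) :=
  [tuple T k w | k < n].

(* The probability that an inhomogeneous Poisson process with the given rate,
   whose number of events in [0, t] is Poisson distributed with mean the
   integral of the rate over [0, t], has no event in [0, t]. *)
Definition no_event (rate : R -> R) (t : R) : R :=
  expR (- (\int[@lebesgue_measure R]_(s in `[0%R, t]) rate s)%R).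

(* Conditionally on the clocks of the first n stages, the clocks of stage n are
   independent, and the i-th one is distributed as the first event time of a
   Poisson process whose rate is the i-th switching rate along the line started
   from the state reached after n switches. The conditional probability of
   {T n i > t i for all i} is spelled out on the events of the past. *)
Definition zigzag_clocks (lambda : 'I_d -> state -> R) (z : state)
    (P : probability Omega R) :=
  [/\ forall n, measurable_fun setT (T n),
      forall n w i, (0 <= tnth (T n w) i)%E &
      forall n (C : set (n.-tuple (d.-tuple (\bar R)))) (t : 'I_d -> R),
        measurable C -> (forall i, 0 <= t i) ->
        P ((past n @^-1` C) `&`
           [set w | forall i, ((t i)%:E < tnth (T n w) i)%E]) =
        (\int[P]_(w in past n @^-1` C)
          (\prod_(i < d) no_event
            (rate_along lambda i (skeleton z (T^~ w) n).2) (t i))%:E)%E].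

(* The law of Z_t on the state space for the process started from z; its total
   mass is 1 if and only if the process almost surely does not explode by t. *)
Definition zigzag_law (P : state -> probability Omega R) (z : state) (t : R)
    (A : set state) : \bar R :=
  P z [set w | exists2 y, zigzag_path z (T^~ w) t = Some y & A y].

End realization.
End zigzag.

Section ergodicity.
Context {R : realType} {dE : measure_display} {E : measurableType dE}.

(* The total variation norm of the difference as a supremum over events; the
   convention that doubles it only changes M by a factor 2. *)
Definition tv_dist (m1 m2 : set E -> \bar R) : \bar R :=
  ereal_sup [set `|m1 A - m2 A|%E | A in measurable].

(* A negative base is excluded because powR rho t = 1 for rho < 0. *)
Definition exponentially_ergodic (law : E -> R -> set E -> \bar R)
    (mu : set E -> \bar R) :=
  exists (M : E -> R) (rho : R),
    [/\ forall z, 1 <= M z, 0 <= rho < 1 &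
        forall z (t : R), 0 <= t ->
          (tv_dist (law z t) mu <= (M z * rho `^ t)%:E)%E].

End ergodicity.

(* Main.v *)
(* The speed of the process has constant coordinates +-1, so at time t every
   coordinate is at distance at most t from its starting value. Started from the
   origin, the process therefore gives no mass at time t = r / (d + 1) to the
   complement of the ball of radius r, and exponential ergodicity bounds
   pi (B(0, r)^c) by a constant times rho^(r / (d + 1)): an exponential tail. *)
Require Import Defs.
From HB Require Import structures.
From mathcomp Require Import all_boot all_order all_algebra.
From mathcomp Require Import all_classical all_reals all_analysis.
From mathcomp Require Import measurable_realfun.
From mathcomp Require Import ring.

Set Implicit Arguments.
Unset Strict Implicit.
Unset Printing Implicit Defensive.

Import Order.TTheory GRing.Theory Num.Theory.
Import numFieldNormedType.Exports.

Local Open Scope classical_set_scope.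
Local Open Scope ring_scope.

Section finite_speed.
Context {R : realType} {d : nat}.
Local Notation state := ('rV[R]_d * d.-tuple bool)%type.
Local Notation clocks := (d.-tuple (\bar R)).

Lemma normr_sgv (v : d.-tuple bool) (i : 'I_d) : `|sgv v i| = 1 :> R.
Proof. by rewrite /sgv normrX normrN1 expr1n. Qed.

Lemma first_clock_ge0 (tau : clocks) :
  (forall i, 0 <= tnth tau i)%E -> (0 <= first_clock tau)%E.
Proof.
move=> tau0; rewrite /first_clock.
apply: (big_ind (fun x => 0 <= x)%E) => // x y x0 y0.
by rewrite le_min x0 y0.
Qed.

Lemma switchE (tau : clocks) (sz : \bar R * state) :
  (switch tau sz).1 = (sz.1 + first_clock tau)%E /\
  (switch tau sz).2.1 = sz.2.1 + fine (first_clock tau) *: vec sz.2.2.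
Proof. by case: sz => s [x v]. Qed.

(** Each stage moves every coordinate by exactly its duration, whence an induction. Finiteness
    matters: if no clock rings the switching time is [+oo], whose [fine] is 0, though earlier
    displacements may be nonzero. *)
Lemma skeleton_speed (z : state) (tau : nat -> clocks) n :
  (forall k i, 0 <= tnth (tau k) i)%E ->
  (0 <= (skeleton z tau n).1)%E /\
  ((skeleton z tau n).1 \is a fin_num -> forall i,
    `|(skeleton z tau n).2.1 ord0 i - z.1 ord0 i| <= fine (skeleton z tau n).1).
Proof.
move=> tau0; elim: n => [|n [s0 IH]].
  by split=> //= _ i; rewrite subrr normr0.
have T0 := first_clock_ge0 (tau0 n).
rewrite [skeleton _ _ _.+1]/=; have [-> ->] := switchE (tau n) (skeleton z tau n).
split; first exact: adde_ge0.
rewrite fin_numD => /andP[sfin Tfin] i; rewrite fineD// !mxE addrAC.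
apply: (le_trans (ler_normD _ _)); rewrite lerD ?IH//.
by rewrite normrM normr_sgv mulr1 ger0_norm// fine_ge0.
Qed.

(** As [xget] defaults to [None], [Some y] comes from an actual stage, begun at some [s <= t]:
    displacement at most [s] before it and [t - s] along it. *)
Lemma zigzag_path_speed (z y : state) (tau : nat -> clocks) (t : R) :
  (forall k i, 0 <= tnth (tau k) i)%E ->
  zigzag_path z tau t = Some y ->
  forall i, `|y.1 ord0 i - z.1 ord0 i| <= t.
Proof.
rewrite /zigzag_path => tau0; case: xgetP => // o _ [n].
have [+ +] := skeleton_speed z n tau0.
case: (skeleton z tau n) => s [x v] /= s0 xs [/andP[st _] ->] [<-] i /=.
have sfin : s \is a fin_num by rewrite ge0_fin_numE// (le_lt_trans st) ?ltry.
have fst : fine s <= t by rewrite -lee_fin fineK.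
rewrite !mxE addrAC (le_trans (ler_normD _ _))// normrM normr_sgv mulr1.
by rewrite (ger0_norm (_ : 0 <= t - _)) ?subr_ge0// -lerBrDr subKr xs.
Qed.

End finite_speed.

Section target_tail.
Context {R : realType} {d : nat}.

(** The sum of squares is at most [d * t ^+ 2]. The factor [d.+1], rather than the root of [d],
    makes the inequality strict and covers [d = 0]. *)
Lemma euclidean_norm_lt (x : 'rV[R]_d) (t : R) : 0 < t ->
  (forall i, `|x ord0 i| <= t) -> euclidean_norm x < d.+1%:R * t.
Proof.
move=> t0 xt; have dt0 : 0 < d.+1%:R * t by rewrite mulr_gt0.
rewrite /euclidean_norm -(gtr0_norm dt0) -sqrtr_sqr ltr_sqrt ?exprn_gt0//.
apply: (@le_lt_trans _ _ (\sum_(i < d) t ^+ 2)).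
  by apply: ler_sum => i _; rewrite -real_normK ?num_real// lerXn2r// ?nnegrE ?ltW.
rewrite sumr_const card_ord -[ltLHS]mulr_natl exprMn ltr_pM2r ?exprn_gt0//.
by rewrite -natrX ltr_nat -mulnn leq_pmulr.
Qed.

Lemma measurable_euclidean_ball0 (r : R) :
  measurable (euclidean_ball0 r : set 'rV[R]_d).
Proof.
rewrite /euclidean_ball0 /euclidean_norm.
have mN : measurable_fun setT
    (fun x : 'rV[R]_d => Num.sqrt (\sum_(i < d) x ord0 i ^+ 2)).
  apply: (measurableT_comp (continuous_measurable_fun (@sqrt_continuous R))).
  apply: measurable_sum => i; apply: measurable_funX.
  exact: measurable_rV_coor.
rewrite -[X in measurable X]setTI.
have := mN measurableT _ (measurable_itv `]-oo, r[).
by congr (measurable (_ `&` _)); apply/seteqP; split => x /=; rewrite in_itv.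
Qed.

Lemma target_measure_ge0 (U : 'rV[R]_d -> R) A : (0 <= target_measure U A)%E.
Proof.
rewrite /target_measure mule_ge0 ?lee_fin ?invr_ge0 ?fine_ge0//;
  by apply: integral_ge0 => x _; rewrite lee_fin expR_ge0.
Qed.

(** Every one of the [2 ^+ d] velocity sections is [A], which cancels the normalizing factor. *)
Lemma extended_target_cylinder (U : 'rV[R]_d -> R) (A : set 'rV[R]_d) :
  extended_target U (A `*` setT) = target_measure U A.
Proof.
rewrite /extended_target (eq_bigr (fun=> target_measure U A)); last first.
  move=> v _; congr target_measure.
  by apply/seteqP; split=> x //= -[].
(* With nonnegative coefficients 1, the common value factors out even if it is infinite. *)
rewrite (eq_bigr (fun=> 1%:E * target_measure U A)%E); last first.
  by move=> v _; rewrite mul1e.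
rewrite -ge0_sume_distrl; last by move=> v _; rewrite lee_fin.
rewrite sumEFin sumr_const card_tuple card_bool natrX muleA -EFinM.
by rewrite mulVf ?mul1e// expf_neq0// pnatr_eq0.
Qed.

Lemma heavy_tailed_exp_unbounded (p : set 'rV[R]_d -> \bar R) (a K : R) :
  0 < a ->
  (forall r, 0 < r -> (p (~` euclidean_ball0 r) * (expR (a * r))%:E <= K%:E)%E) ->
  ~ heavy_tailed p.
Proof.
move=> a0 pK /(_ a a0)/cvgeyPgt/(_ K) pgt.
have [r [Kr r0]] := filter_ex (filterI pgt (nbhs_pinfty_gt (num_real 0))).
by have := pK r r0; rewrite leNgt Kr.
Qed.

End target_tail.

Theorem theorem2p1 (R : realType) (d : nat) (U : 'rV[R]_d -> R)
    (gamma : 'I_d -> 'rV[R]_d -> d.-tuple bool -> R)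
    (dO : measure_display) (Omega : measurableType dO)
    (P : 'rV[R]_d * d.-tuple bool -> probability Omega R)
    (T : nat -> Omega -> d.-tuple (\bar R)) :
  C1 U ->
  (normalization U < +oo)%E ->
  (forall i x v, 0 <= gamma i x v) ->
  independent_of_own_coordinate gamma ->
  (forall i z, locally_integrable setT
    (rate_along (switching_rate U gamma) i z)) ->
  (forall z, zigzag_clocks T (switching_rate U gamma) z (P z)) ->
  heavy_tailed (target_measure U) ->
  ~ exponentially_ergodic (zigzag_law T P) (extended_target U).
Proof.
move=> _ _ _ _ _ clocksP heavy [M [rho [M1 /andP[rho0 rho1] erg]]].
(* rho may be 0, where ln rho = 0 would give no exponential rate. *)
pose q := Num.max rho 2^-1.
have q0 : 0 < q by rewrite lt_max invr_gt0 ltr0n orbT.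
have q1 : q < 1 by rewrite gt_max rho1 invf_lt1 ?ltr1n.
(* From the origin, displacement is position; the velocity is arbitrary. *)
pose z : 'rV[R]_d * d.-tuple bool := (0, [tuple of nseq d false]).
(* The exponent is chosen so that [expR (a * r)] is the inverse of [q] to the power [r / d.+1]. *)
apply: (@heavy_tailed_exp_unbounded _ _ (target_measure U)
  (- ln q / d.+1%:R) (M z)) heavy.
  by rewrite divr_gt0// oppr_gt0 ln_lt0// q0.
move=> r r0; pose t := r / d.+1%:R.
have t0 : 0 < t by rewrite divr_gt0.
pose A : set ('rV[R]_d * d.-tuple bool) := ~` euclidean_ball0 r `*` setT.
have mA : measurable A.
  apply: measurableX => //; apply: measurableC.
  exact: measurable_euclidean_ball0.
(* The event is empty for every [w], not just almost surely, since clocks are nonnegative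
   everywhere. *)
have law0 : zigzag_law T P z t A = 0%E.
  rewrite /zigzag_law (_ : [set w | _] = set0) ?measure0//.
  apply/seteqP; split=> // w [y yt [+ _]]; apply.
  have [_ T0 _] := clocksP z.
  have yz := zigzag_path_speed (fun k => T0 k w) yt.
  rewrite /euclidean_ball0 /= -(divfK (_ : d.+1%:R != 0 :> R) r)// mulrC.
  apply: euclidean_norm_lt => // i.
  by have := yz i; rewrite mxE subr0.
have : (target_measure U (~` euclidean_ball0 r) <= (M z * q `^ t)%:E)%E.
  apply: (@le_trans _ _ (M z * rho `^ t)%:E); last first.
    rewrite lee_fin ler_wpM2l ?(le_trans ler01)//.
    by rewrite ge0_ler_powR ?nnegrE// ?(ltW q0) ?(ltW t0)// /q le_max lexx.
  (* The supremum in [tv_dist] is tested on [A], where the law vanishes. *)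
  apply: le_trans (erg z t (ltW t0)); apply: ereal_sup_ubound.
  exists A => //; rewrite law0 extended_target_cylinder sub0e abseN.
  by rewrite gee0_abs// target_measure_ge0.
move=> /(lee_wpmul2r (_ : 0 <= (expR (- ln q / d.+1%:R * r))%:E)%E).
rewrite lee_fin => /(_ (expR_ge0 _))/le_trans; apply.
(* As [q] is nonzero, its power is [expR (t * ln q)], and the two exponents cancel. *)
rewrite -EFinM lee_fin /powR gt_eqF//= -(mulrA (M z)) -expRD.
rewrite (_ : _ + _ = 0) ?expR0 ?mulr1// /t; ring.
Qed.
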